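(* Let $\Phi$ be an affine root system (the root system, including both real and imaginary roots, of an affine Kac--Moody algebra), and let $S$ be a closed subset of $\Phi$. If $\beta_1,\dots,\beta_n\in S$ (not necessarily distinct) and $$\beta_1+\cdots+\beta_n\in\Phi,$$ then $$\beta_1+\cdots+\beta_n\in S.$$
   Context: **Affine Kac--Moody algebra.** Let $A=(a_{ij})$ be an indecomposable $\ell\times\ell$ generalized Cartan matrix ($a_{ii}=2$; $a_{ij}\in\mathbb{Z}_{\le 0}$ for $i\ne j$; $a_{ij}=0\Rightarrow a_{ji}=0$) that is symmetrizable (there is a diagonal matrix $D=\mathrm{diag}(d_i)$ with all $d_i>0$ such that $DA$ is symmetric) and of affine type, i.e. its symmetrization $DA$ is positive semidefinite of corank $1$. A realization of $A$ is a triple $(\mathfrak{h},\Pi,\Pi^\vee)$ with $\mathfrak{h}$ a complex vector space of dimension $2\ell-\operatorname{rank}(A)$, and $\Pi=\{\alpha_1,\dots,\alpha_\ell\}\subset\mathfrak{h}^*$, $\Pi^\vee=\{\alpha_1^\vee,\dots,\alpha_\ell^\vee\}\subset\mathfrak{h}$ linearly independent sets with $\alpha_j(\alpha_i^\vee)=a_{ij}$. The associated affine Kac--Moody algebra $\mathfrak{g}=\mathfrak{g}(A)$ is the complex Lie algebra generated by $\mathfrak{h}$ and $e_i,f_i$ ($1\le i\le\ell$) with relations $[h,h']=0$, $[e_i,f_j]=\delta_{ij}\alpha_i^\vee$, $[h,e_i]=\alpha_i(h)e_i$, $[h,f_i]=-\alpha_i(h)f_i$ for $h,h'\in\mathfrak{h}$,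 and $(\operatorname{ad}e_i)^{1-a_{ij}}e_j=0=(\operatorname{ad}f_i)^{1-a_{ij}}f_j$ for $i\neq j$. **Roots.** $\mathfrak{g}=\mathfrak{h}\oplus\bigoplus_{\alpha\in\Phi}\mathfrak{g}_\alpha$, where $\mathfrak{g}_\alpha=\{x\in\mathfrak{g}\mid [h,x]=\alpha(h)x\ \forall h\in\mathfrak{h}\}$ and $\Phi\subset\mathfrak{h}^*\setminus\{0\}$ is the set of nonzero $\alpha$ with $\mathfrak{g}_\alpha\neq\{0\}$. **Closedness.** A subset $S\subseteq\Phi$ is closed if $\alpha,\beta\in S$ and $\alpha+\beta\in\Phi$ imply $\alpha+\beta\in S$. *)

(* Defs.v *)
From HB Require Import structures.
From mathcomp Require Import all_boot all_order all_algebra.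
From mathcomp Require Import generic_quotient complex.
From mathcomp Require Import boolp classical_sets reals.

Set Implicit Arguments.
Unset Strict Implicit.
Unset Printing Implicit Defensive.

Import GRing.Theory Num.Theory.
Local Open Scope ring_scope.
Local Open Scope quotient_scope.

HB.mixin Record Lmodule_isLieAlgebra (K : comNzRingType) L
    of GRing.Lmodule K L := {
  lie : L -> L -> L;
  lieDl : forall x y z, lie (x + y) z = lie x z + lie y z;
  lieDr : forall x y z, lie x (y + z) = lie x y + lie x z;
  lieZl : forall a x y, lie (a *: x) y = a *: lie x y;
  lieZr : forall a x y, lie x (a *: y) = a *: lie x y;
  liexx : forall x, lie x x = 0;
  lie_jacobi : forall x y z,
    lie x (lie y z) + lie y (lie z x) + lie z (lie x y) = 0
}.

#[short(type="lieAlgType")]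
HB.structure Definition LieAlgebra (K : comNzRingType) :=
  {L of Lmodule_isLieAlgebra K L & GRing.Lmodule K L}.

(* The Lie K-algebra presented by generators X and relations rel: formal Lie
   expressions over X, modulo the least congruence that contains rel and the
   axioms of Lie K-algebras. *)
Section LiePresentation.
Variables (K : comNzRingType) (X : Type).

Inductive lie_term : Type :=
  | LGen of X
  | LZero
  | LOpp of lie_term
  | LAdd of lie_term & lie_term
  | LScale of K & lie_term
  | LBr of lie_term & lie_term.

HB.instance Definition _ := gen_eqMixin lie_term.
HB.instance Definition _ := gen_choiceMixin lie_term.

Variable rel : lie_term -> lie_term -> Prop.

Inductive lie_cong : lie_term -> lie_term -> Prop :=
  | LC_rel s t : rel s t -> lie_cong s t
  | LC_refl s : lie_cong s s
  | LC_sym s t : lie_cong s t -> lie_cong t s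
  | LC_trans t s u : lie_cong s t -> lie_cong t u -> lie_cong s u
  | LC_opp s s' : lie_cong s s' -> lie_cong (LOpp s) (LOpp s')
  | LC_add s s' t t' : lie_cong s s' -> lie_cong t t' ->
      lie_cong (LAdd s t) (LAdd s' t')
  | LC_scale a s s' : lie_cong s s' -> lie_cong (LScale a s) (LScale a s')
  | LC_br s s' t t' : lie_cong s s' -> lie_cong t t' ->
      lie_cong (LBr s t) (LBr s' t')
  | LC_addA s t u : lie_cong (LAdd s (LAdd t u)) (LAdd (LAdd s t) u)
  | LC_addC s t : lie_cong (LAdd s t) (LAdd t s)
  | LC_add0 s : lie_cong (LAdd LZero s) s
  | LC_addN s : lie_cong (LAdd (LOpp s) s) LZero
  | LC_scaleA a b s : lie_cong (LScale a (LScale b s)) (LScale (a * b) s)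
  | LC_scale1 s : lie_cong (LScale 1 s) s
  | LC_scaleDr a s t :
      lie_cong (LScale a (LAdd s t)) (LAdd (LScale a s) (LScale a t))
  | LC_scaleDl a b s :
      lie_cong (LScale (a + b) s) (LAdd (LScale a s) (LScale b s))
  | LC_brDl s t u : lie_cong (LBr (LAdd s t) u) (LAdd (LBr s u) (LBr t u))
  | LC_brDr s t u : lie_cong (LBr s (LAdd t u)) (LAdd (LBr s t) (LBr s u))
  | LC_brZl a s t : lie_cong (LBr (LScale a s) t) (LScale a (LBr s t))
  | LC_brZr a s t : lie_cong (LBr s (LScale a t)) (LScale a (LBr s t))
  | LC_brxx s : lie_cong (LBr s s) LZero
  | LC_jacobi s t u :
      lie_cong (LAdd (LAdd (LBr s (LBr t u)) (LBr t (LBr u s)))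
                     (LBr u (LBr s t))) LZero.

Definition lie_congb (s t : lie_term) : bool := `[< lie_cong s t >].

Lemma lie_congb_refl : reflexive lie_congb.
Proof. by move=> s; apply/asboolP; exact: LC_refl. Qed.

Lemma lie_congb_sym : symmetric lie_congb.
Proof. by move=> s t; apply/asboolP/asboolP; exact: LC_sym. Qed.

Lemma lie_congb_trans : transitive lie_congb.
Proof.
move=> t s u /asboolP st /asboolP tu; apply/asboolP; exact: LC_trans st tu.
Qed.

Canonical lie_congb_equiv :=
  EquivRel lie_congb lie_congb_refl lie_congb_sym lie_congb_trans.

Definition lie_pres : Type := {eq_quot lie_congb}.
HB.instance Definition _ : EqQuotient _ lie_congb lie_pres :=
  EqQuotient.on lie_pres.
HB.instance Definition _ := Choice.on lie_pres.

Lemma lie_pi_eq s t : \pi_lie_pres s = \pi_lie_pres t <-> lie_cong s t.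
Proof. by split=> [/eqmodP/asboolP|st] //; apply/eqmodP/asboolP. Qed.

Lemma repr_lie_pi s : lie_cong (repr (\pi_lie_pres s)) s.
Proof. by apply/lie_pi_eq; rewrite reprK. Qed.

Definition lp_zero : lie_pres := \pi_lie_pres LZero.
Definition lp_opp (x : lie_pres) : lie_pres := \pi_lie_pres (LOpp (repr x)).
Definition lp_add (x y : lie_pres) : lie_pres :=
  \pi_lie_pres (LAdd (repr x) (repr y)).
Definition lp_scale (a : K) (x : lie_pres) : lie_pres :=
  \pi_lie_pres (LScale a (repr x)).
Definition lp_br (x y : lie_pres) : lie_pres :=
  \pi_lie_pres (LBr (repr x) (repr y)).

Lemma lp_oppE s : lp_opp (\pi_lie_pres s) = \pi_lie_pres (LOpp s).
Proof. by apply/lie_pi_eq; apply: LC_opp; exact: repr_lie_pi. Qed.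

Lemma lp_addE s t :
  lp_add (\pi_lie_pres s) (\pi_lie_pres t) = \pi_lie_pres (LAdd s t).
Proof. by apply/lie_pi_eq; apply: LC_add; exact: repr_lie_pi. Qed.

Lemma lp_scaleE a s : lp_scale a (\pi_lie_pres s) = \pi_lie_pres (LScale a s).
Proof. by apply/lie_pi_eq; apply: LC_scale; exact: repr_lie_pi. Qed.

Lemma lp_brE s t :
  lp_br (\pi_lie_pres s) (\pi_lie_pres t) = \pi_lie_pres (LBr s t).
Proof. by apply/lie_pi_eq; apply: LC_br; exact: repr_lie_pi. Qed.

Fact lp_addA : associative lp_add.
Proof.
elim/quotW=> s; elim/quotW=> t; elim/quotW=> u.
rewrite (lp_addE t u) (lp_addE s t) !lp_addE.
by apply/lie_pi_eq; exact: LC_addA.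
Qed.

Fact lp_addC : commutative lp_add.
Proof.
elim/quotW=> s; elim/quotW=> t; rewrite !lp_addE.
by apply/lie_pi_eq; exact: LC_addC.
Qed.

Fact lp_add0 : left_id lp_zero lp_add.
Proof. by elim/quotW=> s; rewrite lp_addE; apply/lie_pi_eq; exact: LC_add0. Qed.

Fact lp_addN : left_inverse lp_zero lp_opp lp_add.
Proof.
by elim/quotW=> s; rewrite lp_oppE lp_addE;
  apply/lie_pi_eq; exact: LC_addN.
Qed.

HB.instance Definition _ :=
  GRing.isZmodule.Build lie_pres lp_addA lp_addC lp_add0 lp_addN.

Fact lp_scaleA a b x : lp_scale a (lp_scale b x) = lp_scale (a * b) x.
Proof.
by elim/quotW: x => s; rewrite (lp_scaleE b) !lp_scaleE;
  apply/lie_pi_eq; exact: LC_scaleA.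
Qed.

Fact lp_scale1 : left_id 1 lp_scale.
Proof.
by elim/quotW=> s; rewrite lp_scaleE;
  apply/lie_pi_eq; exact: LC_scale1.
Qed.

Fact lp_scaleDr : right_distributive lp_scale +%R.
Proof.
move=> a; elim/quotW=> s; elim/quotW=> t.
by rewrite /GRing.add /= (lp_addE s) !lp_scaleE lp_addE;
  apply/lie_pi_eq; exact: LC_scaleDr.
Qed.

Fact lp_scaleDl x : {morph lp_scale^~ x : a b / a + b}.
Proof.
elim/quotW: x => s a b.
by rewrite [RHS]/GRing.add /= !lp_scaleE lp_addE;
  apply/lie_pi_eq; exact: LC_scaleDl.
Qed.

HB.instance Definition _ := GRing.Zmodule_isLmodule.Build K lie_pres
  lp_scaleA lp_scale1 lp_scaleDr lp_scaleDl.

Fact lp_brDl (x y z : lie_pres) : lp_br (x + y) z = lp_br x z + lp_br y z.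
Proof.
elim/quotW: x => s; elim/quotW: y => t; elim/quotW: z => u.
by rewrite /GRing.add /= (lp_addE s) !lp_brE lp_addE;
  apply/lie_pi_eq; exact: LC_brDl.
Qed.

Fact lp_brDr (x y z : lie_pres) : lp_br x (y + z) = lp_br x y + lp_br x z.
Proof.
elim/quotW: x => s; elim/quotW: y => t; elim/quotW: z => u.
by rewrite /GRing.add /= (lp_addE t) !lp_brE lp_addE;
  apply/lie_pi_eq; exact: LC_brDr.
Qed.

Fact lp_brZl a (x y : lie_pres) : lp_br (a *: x) y = a *: lp_br x y.
Proof.
elim/quotW: x => s; elim/quotW: y => t.
by rewrite /GRing.scale /= (lp_scaleE a s) !lp_brE lp_scaleE;
  apply/lie_pi_eq; exact: LC_brZl.
Qed.

Fact lp_brZr a (x y : lie_pres) : lp_br x (a *: y) = a *: lp_br x y.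
Proof.
elim/quotW: x => s; elim/quotW: y => t.
by rewrite /GRing.scale /= (lp_scaleE a t) !lp_brE lp_scaleE;
  apply/lie_pi_eq; exact: LC_brZr.
Qed.

Fact lp_brxx (x : lie_pres) : lp_br x x = 0.
Proof.
by elim/quotW: x => s; rewrite lp_brE;
  apply/lie_pi_eq; exact: LC_brxx.
Qed.

Fact lp_jacobi (x y z : lie_pres) :
  lp_br x (lp_br y z) + lp_br y (lp_br z x) + lp_br z (lp_br x y) = 0.
Proof.
elim/quotW: x => s; elim/quotW: y => t; elim/quotW: z => u.
by rewrite /GRing.add /= (lp_brE t u) (lp_brE u s) (lp_brE s t) !lp_brE
  (lp_addE (LBr s _)) lp_addE;
  apply/lie_pi_eq; exact: LC_jacobi.
Qed.

HB.instance Definition _ := Lmodule_isLieAlgebra.Build K lie_pres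
  lp_brDl lp_brDr lp_brZl lp_brZr lp_brxx lp_jacobi.

Definition lie_gen (x : X) : lie_pres := \pi_lie_pres (LGen x).

End LiePresentation.

Section CartanMatrix.
Variable l : nat.

Record generalized_Cartan (A : 'M[int]_l) : Prop := {
  gcm_diag : forall i, A i i = 2;
  gcm_offdiag : forall i j, i != j -> A i j <= 0;
  gcm_zero : forall i j, A i j = 0 -> A j i = 0
}.

(* No simultaneous reordering of rows and columns makes A block diagonal
   with two nonempty blocks. *)
Definition indecomposable (A : 'M[int]_l) : Prop :=
  forall I : {set 'I_l}, I != finset.set0 -> I != [set: 'I_l]%SET ->
  exists i j, [/\ i \in I, j \notin I & (A i j != 0) || (A j i != 0)].

Definition symmetrization (R : realType) (d : 'rV[R]_l) (A : 'M[int]_l) :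
    'M[R]_l :=
  diag_mx d *m map_mx intr A.

Definition pos_semidef (R : realType) (M : 'M[R]_l) : Prop :=
  M^T = M /\ forall v : 'cV[R]_l, 0 <= (v^T *m M *m v) 0 0.

(* The rank condition forces 0 < l. *)
Definition affine_type (R : realType) (A : 'M[int]_l) : Prop :=
  exists d : 'rV[R]_l,
    [/\ forall i, 0 < d 0 i,
        pos_semidef (symmetrization d A)
      & (\rank (symmetrization d A)).+1 = l].

Record affine_Cartan (R : realType) (A : 'M[int]_l) : Prop := {
  affine_gcm : generalized_Cartan A;
  affine_indecomposable : indecomposable A;
  affine_affine_type : affine_type R A
}.

End CartanMatrix.

Notation hdual R h := 'Hom(h, R[i]^o).

Section KacMoody.
Variables (R : realType) (l : nat) (A : 'M[int]_l).
Variables (h : vectType R[i]).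
Variables (simple_root : 'I_l -> hdual R h) (simple_coroot : 'I_l -> h).

Record realization : Prop := {
  realization_dim :
    \dim {:h} = (2 * l - \rank (map_mx intr A : 'M[R[i]]_l))%N;
  realization_root_free : free [seq simple_root i | i <- enum 'I_l];
  realization_coroot_free : free [seq simple_coroot i | i <- enum 'I_l];
  realization_pairing :
    forall i j, simple_root j (simple_coroot i) = (A i j)%:~R
}.

Inductive km_generator : Type :=
  | KMh of h
  | KMe of 'I_l
  | KMf of 'I_l.

Local Notation tm := (lie_term R[i] km_generator).
Local Notation H x := (LGen _ (KMh x) : tm).
Local Notation E i := (LGen _ (KMe i) : tm).
Local Notation F i := (LGen _ (KMf i) : tm).

(* KMR_lin makes x |-> H x linear: h enters the presentation as a vector
   space, not merely as a set of generators. *)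
Inductive km_relation : tm -> tm -> Prop :=
  | KMR_lin a x y : km_relation (H (a *: x + y)) (LAdd (LScale a (H x)) (H y))
  | KMR_hh x y : km_relation (LBr (H x) (H y)) (LZero _ _)
  | KMR_ef_eq i : km_relation (LBr (E i) (F i)) (H (simple_coroot i))
  | KMR_ef_neq i j : i != j -> km_relation (LBr (E i) (F j)) (LZero _ _)
  | KMR_he x i : km_relation (LBr (H x) (E i)) (LScale (simple_root i x) (E i))
  | KMR_hf x i :
      km_relation (LBr (H x) (F i)) (LScale (- simple_root i x) (F i))
  | KMR_serre_e i j : i != j ->
      km_relation (iter `|1 - A i j|%N (LBr (E i)) (E j)) (LZero _ _)
  | KMR_serre_f i j : i != j ->
      km_relation (iter `|1 - A i j|%N (LBr (F i)) (F j)) (LZero _ _).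

Definition kac_moody : lieAlgType R[i] := lie_pres km_relation.

Definition km_h (x : h) : kac_moody := lie_gen km_relation (KMh x).

Local Open Scope classical_set_scope.

Definition km_root_space (a : hdual R h) : set kac_moody :=
  [set x | forall t : h, lie (km_h t) x = (a t : R[i]) *: x].

Definition km_roots : set (hdual R h) :=
  [set a | a <> 0 /\ exists2 x, km_root_space a x & x <> 0].

Definition km_closed (S : set (hdual R h)) : Prop :=
  forall a b, S a -> S b -> km_roots (a + b) -> S (a + b).

End KacMoody.

(* Main.v *)
(** Reduce to sums of two terms using the invariant form
    [(u, v) = u D A v^T] on the root lattice, by induction on the number of
    terms. If two terms pair negatively, their sum is zero or a root and they
    can be cancelled or merged. Otherwise, if some term [x] is non-isotropic,
    it pairs positively with the total, so the total minus [x] is zero or a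
    root, to which induction applies. Otherwise all terms are isotropic, and
    it is enough to know that every nonzero isotropic lattice vector is a root
    as soon as one of them is. For this, let [delta] generate the isotropic
    lattice vectors: a maximal root strictly below [delta] is
    [delta - alpha_i], reflections then give all [alpha_i - n delta], and
    [alpha_i - n delta] minus [alpha_i] is a root.

    The root system is only accessed through sign coherence, integrability and
    the Chevalley involution, all of which follow from the presentation; no
    nontriviality of the presented algebra is needed, because any root
    forces the simple roots in its support to be roots. *)
Require Import Defs.
From mathcomp Require Import all_boot all_order all_algebra.
From mathcomp Require Import generic_quotient complex boolp classical_sets reals.
From mathcomp Require Import ring lra zify.

Set Implicit Arguments.
Unset Strict Implicit.
Unset Printing Implicit Defensive.

Import Order.TTheory GRing.Theory Num.Theory.
Local Open Scope ring_scope.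

(** * The affine root lattice *)

Section SemidefiniteForm.
Variables (R : realType) (l : nat) (M : 'M[R]_l).
Hypothesis psdM : pos_semidef M.

Definition mxform (x y : 'rV[R]_l) : R := (x *m M *m y^T) 0 0.

Lemma mxformC x y : mxform x y = mxform y x.
Proof.
rewrite /mxform -[in LHS](trmxK (x *m M *m y^T)) mxE.
by rewrite !trmx_mul trmxK psdM.1 mulmxA.
Qed.

Lemma mxformDl x y z : mxform (x + y) z = mxform x z + mxform y z.
Proof. by rewrite /mxform !mulmxDl mxE. Qed.

Lemma mxformZl a x y : mxform (a *: x) y = a * mxform x y.
Proof. by rewrite /mxform -!scalemxAl mxE. Qed.

Lemma mxformDr x y z : mxform z (x + y) = mxform z x + mxform z y.
Proof. by rewrite mxformC mxformDl !(mxformC z). Qed.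

Lemma mxformZr a x y : mxform y (a *: x) = a * mxform y x.
Proof. by rewrite mxformC mxformZl mxformC. Qed.

Lemma mxform_ge0 x : 0 <= mxform x x.
Proof. by have := psdM.2 x^T; rewrite trmxK. Qed.

(** For isotropic [x], the value of the form at [t *: x + y] is affine in [t] with slope
    [2 * mxform x y]; semidefiniteness forces the slope to vanish. *)
Lemma mxform_isotropic x y : mxform x x = 0 -> mxform x y = 0.
Proof.
move=> xx0; apply/eqP/negPn/negP => xy0.
(* This [t] makes the form take the value [-1] at [t *: x + y]. *)
pose t := - (mxform y y + 1) / (2 * mxform x y).
have := mxform_ge0 (t *: x + y).
rewrite mxformDl !mxformDr !mxformZl !mxformZr xx0 (mxformC y x).
have -> : t * (t * 0) + t * mxform x y + (t * mxform x y + mxform y y) = -1.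
  by rewrite /t; field.
by rewrite lerNr oppr0 ler10.
Qed.

Lemma mxform_isotropic_ker x : mxform x x = 0 -> x *m M = 0.
Proof.
move=> xx0; apply/rowP => j.
have := mxform_isotropic (delta_mx 0 j) xx0.
by rewrite /mxform trmx_delta -colE !mxE.
Qed.

(** Isotropic vectors lie in the left kernel of [M], which is a line because [M] has corank one. *)
Lemma mxform_isotropic_colinear x y : (\rank M).+1 = l -> y != 0 ->
  mxform x x = 0 -> mxform y y = 0 -> exists a, x = a *: y.
Proof.
move=> rkM y0 /mxform_isotropic_ker/sub_kermxP xM.
move=> /mxform_isotropic_ker/sub_kermxP yM.
apply/sub_rVP; apply: submx_trans xM _.
have [_ <-] := mxrank_leqif_sup yM.
by rewrite rank_rV y0 mxrank_ker -[X in (X - _)%N]rkM subSnn.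
Qed.

End SemidefiniteForm.

(** * The invariant form and the simple reflections on the root lattice *)

Section RootLattice.
Variables (R : realType) (l : nat) (A : 'M[int]_l) (d : 'rV[R]_l).
Hypothesis d_gt0 : forall i, 0 < d 0 i.
Hypothesis psdA : pos_semidef (symmetrization d A).
Hypothesis rankA : (\rank (symmetrization d A)).+1 = l.
Hypothesis diagA : forall i, A i i = 2.

Local Notation V := 'rV[int]_l.
Local Notation sr i := (delta_mx 0 i : V).

Definition bil (u v : V) : R :=
  mxform (symmetrization d A) (map_mx intr u) (map_mx intr v).

(** The pairing of [v], written in coordinates with respect to the simple roots, with the [i]-th
    simple coroot. *)
Definition cpair (v : V) (i : 'I_l) : int := \sum_j A i j * v 0 j.

Definition refl (i : 'I_l) (v : V) : V := v - cpair v i *: sr i.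

Lemma bilC u v : bil u v = bil v u.
Proof. exact: mxformC. Qed.

Lemma bilDl u v w : bil (u + v) w = bil u w + bil v w.
Proof. by rewrite /bil map_mxD mxformDl. Qed.

Lemma bilZl a u v : bil (a *: u) v = a%:~R * bil u v.
Proof. by rewrite /bil map_mxZ mxformZl. Qed.

Lemma bilDr u v w : bil w (u + v) = bil w u + bil w v.
Proof. by rewrite bilC bilDl !(bilC w). Qed.

Lemma bilZr a u v : bil v (a *: u) = a%:~R * bil v u.
Proof. by rewrite bilC bilZl bilC. Qed.

Lemma bilNl u v : bil (- u) v = - bil u v.
Proof. by rewrite -scaleN1r bilZl mulN1r. Qed.

Lemma bilNr u v : bil v (- u) = - bil v u.
Proof. by rewrite bilC bilNl bilC. Qed.

Lemma bil0r v : bil v 0 = 0.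
Proof. by rewrite -(scale0r (0 : V)) bilZr mul0r. Qed.

Lemma bil_sumr v s : bil v (\sum_(u <- s) u) = \sum_(u <- s) bil v u.
Proof. by apply: (big_morph (bil v)) => [x y|]; rewrite ?bilDr ?bil0r. Qed.

Lemma bil_ge0 u : 0 <= bil u u.
Proof. exact: mxform_ge0. Qed.

Lemma bil_isotropic u v : bil u u = 0 -> bil u v = 0.
Proof. exact: mxform_isotropic. Qed.

Lemma map_intr_sr i : map_mx intr (sr i) = delta_mx 0 i :> 'rV[R]_l.
Proof. by apply/rowP=> j; rewrite !mxE; case: (_ && _). Qed.

(** Since [d 0 i] is positive, the sign of the form against a simple root is the sign of the coroot
    pairing. This is how the form controls root strings. *)
Lemma bil_sr i v : bil (sr i) v = d 0 i * (cpair v i)%:~R.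
Proof.
rewrite /bil /mxform map_intr_sr -rowE mxE rmorph_sum mulr_sumr.
apply: eq_bigr => j _; rewrite !mxE (bigD1 i) //= big1 => [|k ki].
  by rewrite !mxE eqxx mulr1n addr0 rmorphM mulrA.
by rewrite !mxE eq_sym (negPf ki) mulr0n mul0r.
Qed.

Lemma cpairD u v i : cpair (u + v) i = cpair u i + cpair v i.
Proof. by rewrite -big_split; apply: eq_bigr => j _; rewrite mxE mulrDr. Qed.

Lemma cpairZ a v i : cpair (a *: v) i = a * cpair v i.
Proof. by rewrite mulr_sumr; apply: eq_bigr => j _; rewrite mxE mulrCA. Qed.

Lemma cpairN v i : cpair (- v) i = - cpair v i.
Proof. by rewrite -scaleN1r cpairZ mulN1r. Qed.

Lemma cpair_sr i : cpair (sr i) i = 2.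
Proof.
rewrite /cpair (bigD1 i) //= big1 => [|j ji].
  by rewrite mxE !eqxx mulr1 addr0 diagA.
by rewrite mxE (negPf ji) andbF mulr0.
Qed.

Lemma reflD i u v : refl i (u + v) = refl i u + refl i v.
Proof. by rewrite /refl cpairD scalerDl opprD addrACA. Qed.

Lemma reflZ i a v : refl i (a *: v) = a *: refl i v.
Proof. by rewrite /refl cpairZ scalerBr scalerA. Qed.

Lemma reflN i v : refl i (- v) = - refl i v.
Proof. by rewrite -scaleN1r reflZ scaleN1r. Qed.

Lemma reflK i : involutive (refl i).
Proof.
move=> v; rewrite {1}/refl {1}/refl cpairD cpairN cpairZ cpair_sr.
by rewrite -addrA -opprD -scalerDl [X in X *: _](_ : _ = 0) ?scale0r ?subr0 //; ring.
Qed.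

Lemma refl_sr i : refl i (sr i) = - sr i.
Proof. by rewrite /refl cpair_sr scaler_nat mulr2n opprD addNKr. Qed.

Lemma bil_refl i u v : bil (refl i u) (refl i v) = bil u v.
Proof.
rewrite /refl !(bilDl, bilDr, bilNl, bilNr, bilZl, bilZr).
by rewrite (bilC u (sr i)) !bil_sr cpair_sr; ring.
Qed.

Lemma bil_sr_gt0 i : 0 < bil (sr i) (sr i).
Proof. by rewrite bil_sr cpair_sr mulr_gt0 ?ltr0z. Qed.

Lemma reflE i v j : j != i -> refl i v 0 j = v 0 j.
Proof. by move=> ji; rewrite !mxE (negPf ji) andbF mulr0 subr0. Qed.

(** Weyl group elements are represented by words in the simple reflections; the reversed word acts
    as the inverse. *)
Definition refls (s : seq 'I_l) (v : V) : V := foldr refl v s.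

Lemma reflsD s u v : refls s (u + v) = refls s u + refls s v.
Proof. by elim: s => //= i s ->; exact: reflD. Qed.

Lemma reflsZ s a v : refls s (a *: v) = a *: refls s v.
Proof. by elim: s => //= i s ->; exact: reflZ. Qed.

Lemma bil_refls s u v : bil (refls s u) (refls s v) = bil u v.
Proof. by elim: s => //= i s <-; exact: bil_refl. Qed.

Lemma refls_rev s v : refls s (refls (rev s) v) = v.
Proof.
elim: s v => //= i s IHs v.
by rewrite rev_cons {2}/refls foldr_rcons -/(refls _ _) IHs reflK.
Qed.

Definition nonneg (v : V) : Prop := forall j, 0 <= v 0 j.

(** * Abstract root sets in the lattice: real roots and their strings *)

Variable P : V -> Prop.
Hypothesis P_neq0 : ~ P 0.
Hypothesis P_sign : forall v, P v -> nonneg v \/ nonneg (- v).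
Hypothesis P_opp : forall v, P v -> P (- v).
Hypothesis P_string :
  forall v i, P v -> cpair v i < 0 -> v + sr i = 0 \/ P (v + sr i).
Hypothesis P_refl : forall v i, P v -> P (refl i v).
Hypothesis P_multiple : forall (a : int) i, P (a *: sr i) -> a = 1 \/ a = -1.
Hypothesis P_support : forall v j, P v -> v 0 j != 0 -> P (sr j).

Lemma P_refls s v : P v -> P (refls s v).
Proof. by move=> Pv; elim: s => //= i s; exact: P_refl. Qed.

Definition height (v : V) : int := \sum_j v 0 j.

Lemma height_ge0 v : nonneg v -> 0 <= height v.
Proof. by move=> v0; apply: sumr_ge0. Qed.

Lemma height_eq0 v : nonneg v -> height v = 0 -> v = 0.
Proof.
move=> v0 /eqP; rewrite /height psumr_eq0 // => /allP v00.
by apply/rowP => j; rewrite mxE; apply/eqP/v00/mem_index_enum.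
Qed.

Lemma rowE_sr (v : V) : v = \sum_j v 0 j *: sr j.
Proof.
apply/rowP => j; rewrite summxE (bigD1 j) //= big1 => [|k kj].
  by rewrite !mxE !eqxx mulr1 addr0.
by rewrite !mxE eq_sym (negPf kj) andbF mulr0.
Qed.

Lemma bilE_sr u v : bil u v = \sum_j (u 0 j)%:~R * bil (sr j) v.
Proof.
rewrite {1}(rowE_sr u).
under [RHS]eq_bigr do rewrite -bilZl.
apply: (big_morph (bil^~ v)) => [x y|]; first by rewrite bilDl.
by rewrite bilC bil0r.
Qed.

(* A reflection lowering the height of a positive root keeps it positive
   unless the root is simple. *)
Lemma real_root_refls v : P v -> 0 < bil v v ->
  exists s i, v = refls s (sr i).
Proof.
suff pos n : forall v : V, (`|height v| <= n)%N -> nonneg v -> P v ->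
    0 < bil v v -> exists s i, v = refls s (sr i).
  move=> Pv vv; case: (P_sign Pv) => [v0|v0]; first exact: pos (leqnn _) v0 Pv vv.
  have [|s [i vE]] := pos _ _ (leqnn _) v0 (P_opp Pv).
    by rewrite bilNl bilNr opprK.
  (* The simple reflection [i] negates [sr i], so one more letter at the inner end of the word
     changes the sign. *)
  exists (rcons s i), i.
  by rewrite /refls foldr_rcons refl_sr -[LHS]opprK vE -!scaleN1r -reflsZ.
elim: n => [|n IHn] {}v leh v0 Pv vv.
  case: P_neq0; rewrite -(height_eq0 v0) //; first by lia.
case: (pselect (exists i, v = sr i)) => [[i ->]|nsr]; first by exists [::], i.
(* Expand [bil v v] along the coordinates of the first argument: a positive sum of terms has a
   positive term. *)
have [i vi vpi] : exists2 i, 0 < v 0 i & 0 < cpair v i.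
  apply: contrapT => H; move: vv; rewrite bilE_sr ltNge => /negP; apply.
  apply: sumr_le0 => i _; rewrite bil_sr.
  have := v0 i; rewrite le_eqVlt => /orP[/eqP<-|vi]; first by rewrite mul0r.
  apply: mulr_ge0_le0; first by rewrite ler0z ltW.
  apply: mulr_ge0_le0; first exact/ltW.
  rewrite lerz0 leNgt; apply/negP => ?; apply: H.
  by exists i.
have w0 : nonneg (refl i v).
  (* The reflection alters only coordinate [i]. If the image were negative, [v] would be supported
     at [i] alone, hence simple by [P_multiple]. *)
  case: (P_sign (P_refl i Pv)) => // Hneg; exfalso.
  have z j : j != i -> v 0 j = 0.
    by move=> ji; have := v0 j; have := Hneg j; rewrite mxE reflE //; lia.
  have vE : v = v 0 i *: sr i.
    rewrite {1}(rowE_sr v) (bigD1 i) //= big1 ?addr0 // => j ji.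
    by rewrite z // scale0r.
  have := Pv; rewrite vE => /P_multiple[] E.
    by apply: nsr; exists i; rewrite vE E scale1r.
  by move: vi; rewrite E.
have sumE : height (refl i v) = height v - cpair v i.
  rewrite /height (bigD1 i) //= [X in _ = X - _](bigD1 i) //=.
  rewrite [X in _ + X = _](eq_bigr (fun j => v 0 j)); last first.
    by move=> j ji; rewrite reflE.
  by rewrite !mxE !eqxx mulr1; ring.
have [||||s [k E]] := IHn (refl i v).
- have := height_ge0 w0; have := height_ge0 v0.
  by rewrite sumE; lia.
- by [].
- exact: P_refl.
- by rewrite bil_refl.
by exists (i :: s), k; rewrite /= -E reflK.
Qed.

Lemma bil_neg_gt0 u v : bil u v < 0 -> 0 < bil u u.
Proof.
move=> uv; rewrite lt_neqAle bil_ge0 andbT eq_sym; apply/eqP => u0.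
by move: uv; rewrite bil_isotropic // ltxx.
Qed.

(** Negative pairing makes [u] real, so a Weyl group element carries it to a simple root, where the
    claim is [P_string]. *)
Lemma root_addP u v : P u -> P v -> bil u v < 0 -> u + v = 0 \/ P (u + v).
Proof.
move=> Pu Pv uv.
have [s [i uE]] := real_root_refls Pu (bil_neg_gt0 uv).
pose w := refls (rev s) v.
have vE : v = refls s w by rewrite refls_rev.
have : cpair w i < 0.
  have := uv; rewrite uE vE bil_refls bil_sr pmulr_rlt0 //.
  by rewrite ltrz0.
case/(P_string (P_refls _ Pv)) => E.
  by left; rewrite uE vE -reflsD addrC E -(scale0r (0 : V)) reflsZ !scale0r.
by right; rewrite uE vE -reflsD addrC; exact: P_refls.
Qed.

(** The reflection in a real root is conjugate to a simple one; [a] is the integer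
    [2 (u, v) / (u, u)]. *)
Lemma root_reflect u v a : P u -> P v -> 0 < bil u u ->
  2 * bil u v = a%:~R * bil u u -> P (v - a *: u).
Proof.
move=> Pu Pv uu; have [s [i uE]] := real_root_refls Pu uu.
pose w := refls (rev s) v.
have vE : v = refls s w by rewrite refls_rev.
rewrite uE vE !bil_refls !bil_sr cpair_sr => E.
have -> : a = cpair w i.
  apply: (@intr_inj R); apply: (mulfI (lt0r_neq0 (d_gt0 i))).
  by move: E; lra.
rewrite -scaleNr -reflsZ -reflsD scaleNr.
by apply/P_refls/P_refl/P_refls.
Qed.

(** * Isotropic vectors and imaginary roots *)

Definition isotropic (v : V) : Prop := bil v v = 0.

Lemma isotropicZ a v : isotropic v -> isotropic (a *: v).
Proof. by move=> v0; rewrite /isotropic bilZl bil_isotropic ?mulr0. Qed.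

Lemma isotropicD u v : isotropic u -> isotropic v -> isotropic (u + v).
Proof.
move=> u0 v0.
rewrite /isotropic bilDl !(bilC _ (u + v)) !bilDl.
by rewrite !(bil_isotropic _ u0) !(bil_isotropic _ v0) !addr0.
Qed.

(** Take [delta] of least height among the nonzero nonnegative isotropic lattice vectors. Division
    with remainder by [delta] leaves a nonnegative isotropic vector of smaller height, that is,
    zero. *)
Lemma min_isotropic v : P v -> isotropic v ->
  exists2 delta : V, [/\ nonneg delta, delta != 0 & isotropic delta] &
  forall w, isotropic w -> exists a, w = a *: delta.
Proof.
move=> Pv v0.
pose Q n := `[< exists w : V, [/\ nonneg w, w != 0, isotropic w & `|height w|%N = n] >].
have exQ : exists n, Q n.
  have vn0 : v != 0 by apply/eqP => E; apply: P_neq0; rewrite -E.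
  case: (P_sign Pv) => vs.
    by exists `|height v|%N; apply/asboolP; exists v.
  exists `|height (- v)|%N; apply/asboolP; exists (- v); split => //.
    by rewrite oppr_eq0.
  by rewrite -scaleN1r; exact: isotropicZ.
case: (ex_minnP exQ) => n /asboolP[delta [dge0 dn0 diso dn]] dmin.
exists delta => // w wiso.
have [r wE] : exists r : R, map_mx intr w = r *: map_mx intr delta.
  apply: (mxform_isotropic_colinear psdA rankA) => //.
  apply: contraNneq dn0 => /rowP E; apply/eqP/rowP => j.
  by apply/eqP; move: (E j); rewrite !mxE => /eqP; rewrite intr_eq0.
have wEj j : (w 0 j)%:~R = r * (delta 0 j)%:~R :> R.
  by have /rowP/(_ j) := wE; rewrite !mxE.
(* Over the reals [w] is [r] times [delta]; the remainder [w - a *: delta] has ratio [r - a] in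
   [[0, 1)]. *)
pose a := Num.floor r; exists a.
pose u := w - a *: delta.
have uEj j : (u 0 j)%:~R = (r - a%:~R) * (delta 0 j)%:~R :> R.
  by rewrite !mxE rmorphB rmorphM /= wEj mulrBl.
have uge0 : nonneg u.
  move=> j; rewrite -(@ler0z R) uEj mulr_ge0 ?ler0z //.
  by rewrite subr_ge0 floor_le.
apply/eqP; rewrite -subr_eq0; apply/negPn/negP => un0.
have /dmin : Q `|height u|%N.
  apply/asboolP; exists u; split => //.
  by rewrite /u -scaleNr; apply/isotropicD/isotropicZ.
rewrite -dn => len.
have : height u < height delta.
  rewrite /height -(@ltr_int R) !rmorph_sum /=.
  under eq_bigr do rewrite uEj.
  rewrite -mulr_sumr -rmorph_sum /= -/(height delta) -[ltRHS]mul1r ltr_pM2r.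
    by rewrite ltrBlDl; have := floorD1_gt r; rewrite rmorphD.
  rewrite ltr0z lt_neqAle height_ge0 // andbT eq_sym.
  by apply: contraNneq dn0 => /height_eq0->.
have := height_ge0 uge0; have := height_ge0 dge0.
by move: len; lia.
Qed.

(* A root of maximal height strictly below [delta] is real, so it pairs
   negatively with [delta] minus itself; it can then only differ from [delta]
   by a simple root. *)
Lemma pred_isotropic_root (delta : V) j : nonneg delta -> delta != 0 ->
    isotropic delta ->
    (forall w, isotropic w -> exists a, w = a *: delta) ->
    P (sr j) -> 0 < delta 0 j ->
  exists i, [/\ P (sr i), P delta & P (delta - sr i)].
Proof.
move=> dge0 dn0 diso dgen Pj dj0.
pose below (u : V) := [/\ P u, nonneg u, nonneg (delta - u) & u != delta].
pose Q n := `[< exists2 u : V, below u & `|height u|%N = n >].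
(* The simple root [sr j] qualifies: it lies below [delta] because [delta 0 j] is positive, and
   differs from it because it is not isotropic. *)
have exQ : exists n, Q n.
  exists `|height (sr j)|%N; apply/asboolP; exists (sr j) => //; split=> //.
  - by move=> k; rewrite mxE; case: (_ && _).
  - move=> k; have := dge0 k; rewrite !mxE eqxx /=.
    case: eqP => [->|_] /=; last by rewrite subr0.
    by move: dj0; lia.
  - apply: contraPneq diso => <-; rewrite /isotropic => E.
    by have := bil_sr_gt0 j; rewrite E ltxx.
have heightB u : height (delta - u) = height delta - height u.
  by rewrite /height -sumrB; apply: eq_bigr => k _; rewrite !mxE.
have Qbound n : Q n -> (n <= `|height delta|)%N.
  move=> /asboolP[u [_ u0 du0 _] <-].
  by have := height_ge0 u0; have := height_ge0 du0; rewrite heightB; lia.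
case: (ex_maxnP exQ Qbound) => n /asboolP[u [Pu u0 du0 und] un] umax.
(* An isotropic [u] would be [a *: delta] with [0 <= a <= 1], hence [0] or [delta], both
   excluded. *)
have uu : 0 < bil u u.
  rewrite lt_neqAle bil_ge0 andbT eq_sym; apply/eqP => /dgen[a uE].
  have : (0 <= a) && (a <= 1).
    have := u0 j; have := du0 j; rewrite uE !mxE -{1}[delta 0 j]mul1r -mulrBl.
    by rewrite !pmulr_lge0 // subr_ge0 => -> ->.
  case/andP=> a0 a1; have [E|E] : a = 0 \/ a = 1 by lia.
    by apply: P_neq0; rewrite -(scale0r delta) -E -uE.
  by move/eqP: und; rewrite uE E scale1r.
have : bil (delta - u) u < 0.
  by rewrite bilDl bilNl bil_isotropic // add0r oppr_lt0.
(* Expanding [bil (delta - u) u] along [delta - u] yields a simple root that occurs in [delta - u]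
   and pairs negatively with [u]. *)
have [[i [dui cui]]|H] :=
    pselect (exists i, 0 < (delta - u) 0 i /\ cpair u i < 0); last first.
  rewrite ltNge bilE_sr => /negP[]; apply: sumr_ge0 => i _; rewrite bil_sr.
  have := du0 i; rewrite le_eqVlt => /orP[/eqP<-|dui]; first by rewrite mul0r.
  apply: mulr_ge0; first by rewrite ler0z ltW.
  apply: mulr_ge0; first exact/ltW.
  rewrite ler0z leNgt.
  by apply/negP => ?; apply: H; exists i.
move=> _; exists i.
have sri k : (sr i) 0 k = (k == i)%:R by rewrite mxE eqxx.
case: (P_string Pu cui) => [/rowP/(_ i)|Pui].
  by have := u0 i; rewrite !mxE !eqxx /=; lia.
have [E|ne] := eqVneq (u + sr i) delta.
  have Pd : P delta by rewrite -E.
  split=> //; last by rewrite -E addrK.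
  apply: (P_support Pd); move: dui; rewrite !mxE subr_gt0 => dui.
  by rewrite gt_eqF // (le_lt_trans (u0 i)).
(* Otherwise [u + sr i] is still strictly below [delta], against the maximality of the height of
   [u]. *)
have /umax : Q `|height (u + sr i)|%N.
  apply/asboolP; exists (u + sr i) => //; split=> //.
    by move=> k; rewrite mxE sri addr_ge0.
  move=> k; have := du0 k; rewrite opprD addrA.
  rewrite [X in _ -> _ <= X]mxE [(- sr i) _ _]mxE sri.
  by case: (eqVneq k i) => [->|_]; [rewrite subr_ge0|rewrite subr0].
have -> : height (u + sr i) = height u + 1.
  rewrite /height -[1](_ : \sum_k (sr i) 0 k = 1).
    by rewrite -big_split; apply: eq_bigr => k _; rewrite [LHS]mxE.
  rewrite (bigD1 i) //= big1 => [|k ki]; first by rewrite sri eqxx addr0.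
  by rewrite sri (negPf ki).
by have := height_ge0 u0; rewrite -un; lia.
Qed.

(* [sr i] and [delta - sr i] are real roots; reflecting the members of the
   string [sr i - n *: delta] in one another produces the whole string. *)
Lemma isotropic_root v w : P v -> isotropic v -> isotropic w -> w != 0 -> P w.
Proof.
move=> Pv viso wiso wn0.
have [delta [dge0 dn0 diso] dgen] := min_isotropic Pv viso.
have [a vE] := dgen v viso.
have [j dj0] : exists j, 0 < delta 0 j.
  apply: contrapT => H; case/eqP: dn0; apply/rowP => j; rewrite mxE.
  apply/eqP; rewrite eq_le dge0 andbT leNgt.
  by apply/negP => ?; apply: H; exists j.
(* [v] is a nonzero multiple of [delta], so [j] is in its support. *)
have Pj : P (sr j).
  apply: (P_support Pv); rewrite vE mxE mulf_neq0 ?(gt_eqF dj0) //.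
  by apply/eqP => a0; apply: P_neq0; rewrite -(scale0r delta) -a0 -vE.
have [i [Pi Pd Pdi]] := pred_isotropic_root dge0 dn0 diso dgen Pj dj0.
pose c (n : nat) := sr i - n%:Z *: delta.
have bilc m n : bil (c m) (c n) = bil (sr i) (sr i).
  rewrite /c bilDl !bilDr !bilNl !bilNr !bilZl !bilZr (bilC (sr i) delta).
  by rewrite !(bil_isotropic _ diso) !(mulr0, oppr0, addr0).
have Pc n : P (c n) /\ P (c n.+1).
  elim: n => [|n [IH0 IH1]].
    by rewrite /c scale0r subr0 scale1r -opprB; split=> //; exact: P_opp.
  split=> //; rewrite -[c _]opprK; apply: P_opp.
  (* All [c n] have the same norm and the same mutual pairings, so reflecting [c n] in [c n.+1]
     subtracts exactly twice the latter. *)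
  have -> : - c n.+2 = c n - 2 *: c n.+1.
    by apply/rowP => k; rewrite !mxE; lia.
  by apply: root_reflect => //; rewrite !bilc // bil_sr_gt0.
have Pnd (n : nat) : P (n.+1%:Z *: delta).
  have c0 : sr i = c 0%N by rewrite /c scale0r subr0.
  (* [- sr i] pairs negatively with [c n.+1], and their sum is [- (n.+1 *: delta)]. *)
  have := root_addP (P_opp Pi) (Pc n.+1).1; rewrite c0 bilNl bilc.
  rewrite oppr_lt0 bil_sr_gt0 => /(_ isT).
  rewrite (_ : - c 0%N + c n.+1 = - (n.+1%:Z *: delta)); last first.
    by apply/rowP => k; rewrite !mxE; lia.
  case=> [/rowP/(_ j)/eqP|/P_opp]; last by rewrite opprK.
  by rewrite !mxE oppr_eq0 mulf_eq0 (gt_eqF dj0).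
have [b wE] := dgen w wiso; move: wn0; rewrite wE.
case: b {wE} => [[|n]|n]; first by rewrite scale0r eqxx.
  by move=> _; exact: Pnd.
by rewrite NegzE scaleNr => _; exact/P_opp/Pnd.
Qed.

(** Partial sums in a given order need not be roots, so the form selects which terms to merge,
    cancel or split off; the induction is on the number of terms. *)
Lemma closed_sum (S : V -> Prop) (s : seq V) :
    (forall v, S v -> P v) ->
    (forall u v, S u -> S v -> P (u + v) -> S (u + v)) ->
    (forall v, v \in s -> S v) -> P (\sum_(v <- s) v) ->
  S (\sum_(v <- s) v).
Proof.
move=> SP Scl; have [n] := ubnP (size s).
elim: n s => // n IHn s les sS Ps.
have [[x [y [t [st xy]]]]|H] := pselect (exists x y t,
    perm_eq s [:: x, y & t] /\ bil x y < 0).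
  have xyS z : z \in [:: x, y & t] -> S z by rewrite -(perm_mem st); exact: sS.
  have Sx : S x by apply: xyS; rewrite !inE eqxx.
  have Sy : S y by apply: xyS; rewrite !inE eqxx orbT.
  have St z : z \in t -> S z by move=> zt; apply: xyS; rewrite !inE zt !orbT.
  move: les Ps; rewrite (perm_size st) (perm_big _ st) /= !big_cons addrA.
  move=> les Ps; case: (root_addP (SP _ Sx) (SP _ Sy) xy) => [xy0|Pxy].
    move: Ps; rewrite xy0 add0r; apply: IHn => //.
    by move: les; rewrite !ltnS; exact: ltnW.
  have -> : x + y + \sum_(j <- t) j = \sum_(j <- (x + y) :: t) j.
    by rewrite big_cons.
  apply: IHn => //; last by rewrite big_cons.
  move=> z; rewrite inE => /orP[/eqP->|]; last exact: St.
  exact: Scl.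
(* With no negative pair left, the other terms contribute nonnegatively to the pairing of [x] with
   the total. *)
have {H} bil_ge x : x \in s -> bil x x <= bil x (\sum_(v <- s) v).
  move=> xs; rewrite bil_sumr (perm_big _ (perm_to_rem xs)) /= big_cons.
  rewrite lerDl big_seq; apply: sumr_ge0 => y ys.
  rewrite leNgt; apply/negP => xy; apply: H; exists x, y, (rem y (rem x s)).
  split=> //; apply: perm_trans (perm_to_rem xs) _.
  by rewrite perm_cons perm_to_rem.
(* Splitting off one term: the remaining sum lies in [S] by induction once it is known to be a
   root. *)
have step x : x \in s ->
    (let w := \sum_(v <- rem x s) v in w = 0 \/ P w) -> S (\sum_(v <- s) v).
  move=> xs; move: (sS _ xs) (Ps); rewrite (perm_big _ (perm_to_rem xs)) /=.
  rewrite big_cons => Sx Pxw [->|Pw]; first by rewrite addr0.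
  apply: Scl => //; apply: IHn => //; last by move=> v /mem_rem; exact: sS.
  by rewrite size_rem // prednK //; case: (s) xs.
have sumrem x : x \in s ->
    \sum_(v <- rem x s) v = \sum_(v <- s) v - x.
  move=> xs; rewrite (perm_big _ (perm_to_rem xs)) /= big_cons.
  by rewrite addrAC subrr add0r.
have [[x [xs xx]]|H] := pselect (exists x, x \in s /\ 0 < bil x x).
  apply: (step x xs); rewrite /= sumrem // addrC.
  apply: root_addP => //; first exact/P_opp/SP/sS.
  by rewrite bilNl oppr_lt0; exact: lt_le_trans xx (bil_ge _ xs).
have siso x : x \in s -> isotropic x.
  move=> xs; apply/eqP; rewrite eq_le bil_ge0 andbT leNgt.
  by apply/negP => xx; apply: H; exists x.
case: s les sS Ps bil_ge step sumrem siso {H} => [|x s] les sS Ps bil_ge step sumrem siso.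
  by move: Ps; rewrite big_nil => /P_neq0.
have xs : x \in x :: s by rewrite inE eqxx.
(* All terms are isotropic here, so any of them may be split off: the rest is isotropic, hence zero
   or a root. *)
apply: (step x xs) => /=; rewrite eqxx.
have [->|sn0] := eqVneq (\sum_(v <- s) v) 0; first by left.
right; apply: isotropic_root (SP _ (sS _ xs)) (siso _ xs) _ sn0.
have : forall y, y \in s -> isotropic y.
  by move=> y ys; apply: siso; rewrite inE ys orbT.
elim: (s) => [|y t IHt] tiso; first by rewrite big_nil /isotropic bil0r.
rewrite big_cons; apply: isotropicD; first by apply: tiso; rewrite inE eqxx.
by apply: IHt => z zt; apply: tiso; rewrite inE zt orbT.
Qed.

End RootLattice.

(** * Lie algebras *)

Section LieTheory.
Variables (K : comNzRingType) (L : lieAlgType K).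
Implicit Types x y z : L.

Lemma lie0l x : lie 0 x = 0.
Proof. by have := lieZl 0 0 x; rewrite !scale0r. Qed.

Lemma lie0r x : lie x 0 = 0.
Proof. by have := lieZr 0 x 0; rewrite !scale0r. Qed.

Lemma lieNl x y : lie (- x) y = - lie x y.
Proof. by rewrite -scaleN1r lieZl scaleN1r. Qed.

Lemma lieNr x y : lie x (- y) = - lie x y.
Proof. by rewrite -scaleN1r lieZr scaleN1r. Qed.

Lemma lie_sumr I (r : seq I) x F :
  lie x (\sum_(i <- r) F i) = \sum_(i <- r) lie x (F i).
Proof. by apply: (big_morph (lie x)) => [y z|]; rewrite ?lieDr ?lie0r. Qed.

Lemma lieC x y : lie x y = - lie y x.
Proof.
apply/eqP; rewrite -addr_eq0; apply/eqP.
by have := liexx (x + y); rewrite lieDl !lieDr !liexx addr0 add0r.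
Qed.

Lemma lie_leibniz x y z : lie x (lie y z) = lie (lie x y) z + lie y (lie x z).
Proof.
apply/eqP; rewrite -subr_eq0 opprD addrA (lieC (lie x y) z) opprK.
by rewrite -lieNr -lieC addrAC lie_jacobi.
Qed.

Definition ad_nil x y : Prop := exists n, iter n (lie x) y = 0.

Lemma iter_lieD n x y z :
  iter n (lie x) (y + z) = iter n (lie x) y + iter n (lie x) z.
Proof. by elim: n => //= n ->; rewrite lieDr. Qed.

Lemma iter_lieZ n a x y : iter n (lie x) (a *: y) = a *: iter n (lie x) y.
Proof. by elim: n => //= n ->; rewrite lieZr. Qed.

Lemma iter_lie0 n x : iter n (lie x) 0 = 0.
Proof. by elim: n => //= n ->; rewrite lie0r. Qed.

Lemma ad_nilD x y z : ad_nil x y -> ad_nil x z -> ad_nil x (y + z).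
Proof.
move=> [m ym] [n zn]; exists (m + n)%N; rewrite iter_lieD.
by rewrite {1}addnC !iterD ym zn !iter_lie0 addr0.
Qed.

Lemma ad_nilZ a x y : ad_nil x y -> ad_nil x (a *: y).
Proof. by move=> [m ym]; exists m; rewrite iter_lieZ ym scaler0. Qed.

(** [lie x] is a derivation, so each application lowers the nilpotency exponent of one of the two
    factors; the induction is on the sum of the exponents. *)
Lemma ad_nil_lie x y z : ad_nil x y -> ad_nil x z -> ad_nil x (lie y z).
Proof.
move=> [m ym] [n zn]; exists (m + n)%N.
move kE: (m + n)%N => k; elim: k m n kE y z ym zn => [|k IHk].
  by move=> [|//] [|//] _ y z /= -> ->; rewrite lie0l.
move=> [|m] n kE y z ym zn.
  by rewrite (_ : y = 0) // lie0l iter_lie0.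
case: n kE zn => [|n] kE zn.
  by rewrite (_ : z = 0) // lie0r iter_lie0.
rewrite iterSr lie_leibniz iter_lieD.
rewrite (IHk m n.+1) //; [|by lia|by rewrite -iterSr].
by rewrite (IHk m.+1 n) ?addr0 //; [by lia|rewrite -iterSr].
Qed.

End LieTheory.

(** * Locally nilpotent [sl2]-actions *)

Section Sl2.
Variables (K : numFieldType) (L : lieAlgType K) (e f c : L).
Hypotheses (ef : lie e f = c) (ce : lie c e = 2 *: e) (cf : lie c f = - 2 *: f).

Lemma sl2_weight_e a x n :
  lie c x = a *: x -> lie c (iter n (lie e) x) = (a + 2 * n%:R) *: iter n (lie e) x.
Proof.
move=> cx; elim: n => [|n IHn] /=; first by rewrite mulr0 addr0.
rewrite lie_leibniz ce lieZl IHn lieZr -scalerDl -natr1; congr (_ *: _); ring.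
Qed.

Lemma sl2_weight_f a x n :
  lie c x = a *: x -> lie c (iter n (lie f) x) = (a - 2 * n%:R) *: iter n (lie f) x.
Proof.
move=> cx; elim: n => [|n IHn] /=; first by rewrite mulr0 subr0.
rewrite lie_leibniz cf lieZl IHn lieZr -scalerDl -natr1; congr (_ *: _); ring.
Qed.

Lemma sl2_commutation a x n : lie c x = a *: x ->
  lie e (iter n.+1 (lie f) x) =
  iter n.+1 (lie f) (lie e x) + (n.+1%:R * (a - n%:R)) *: iter n (lie f) x.
Proof.
move=> cx; elim: n => [|n IHn].
  by rewrite /= lie_leibniz ef cx addrC mul1r subr0.
rewrite [iter n.+2 _ x]iterS lie_leibniz ef (sl2_weight_f _ cx) IHn.
rewrite lieDr lieZr addrCA -!iterS; congr (_ + _).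
by rewrite -scalerDl; congr (_ *: _); rewrite -!natr1; ring.
Qed.

(** The coefficient [n.+1 * (a - n)] in [sl2_commutation] never vanishes for [a < 0], so a vanishing
    power of [lie f] on [x] can be lowered down to the power zero. *)
Lemma sl2_highest_lt0 a x : lie c x = a *: x -> a < 0 -> lie e x = 0 ->
  ad_nil f x -> x = 0.
Proof.
move=> cx a0 ex [n]; elim: n => //= n IHn fx; apply: IHn.
have := sl2_commutation n cx; rewrite ex iter_lie0 /= fx lie0r add0r.
move/esym/eqP; rewrite scaler_eq0 mulf_eq0 pnatr_eq0 /=.
rewrite lt_eqF ?orFb => [/eqP //|].
by rewrite subr_lt0 (lt_le_trans a0) ?ler0n.
Qed.

(** Injectivity of the [m]-th power of [lie f] on weight [m]. Induction on the nilpotency exponent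
    of [lie e] reduces to showing that the top vector [y] of the [e]-string is zero. *)
Lemma sl2_string (m : nat) x : lie c x = m%:R *: x -> ad_nil e x ->
  iter m (lie f) x = 0 -> x = 0.
Proof.
move=> cx [n]; elim: n => //= n IHn ex fx; apply: IHn => //.
set y := iter n (lie e) x in ex *.
(* Each further [lie e] on [x] costs one more [lie f]: the correction term in [sl2_commutation] is a
   multiple of the vector already known to vanish. *)
have {fx} : iter (m + n) (lie f) y = 0.
  rewrite {ex}/y; elim: n => [|n IHn]; first by rewrite addn0.
  have := sl2_commutation (m + n) (sl2_weight_e n cx).
  by rewrite IHn scaler0 addr0 addnS iterS IHn !lie0r => <-.
have : (m + n <= m + n)%N by [].
(* [y] is killed by [e] and has weight [m + 2 * n], so the coefficient [j.+1 * (m + 2 * n - j)] is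
   positive for [j < m + n] and the power of [lie f] can be lowered to zero. *)
elim: {1 3}(m + n)%N => //= j IHj jn fy; apply: IHj; first exact: ltnW.
have := sl2_commutation j (sl2_weight_e n cx).
rewrite -/y ex iter_lie0 /= fy lie0r add0r => /esym/eqP.
rewrite scaler_eq0 mulf_eq0 pnatr_eq0 /= gt_eqF ?orFb => [/eqP //|].
rewrite subr_gt0 -natrM -natrD ltr_nat; lia.
Qed.

End Sl2.

(** * Induction principle and universal property of presented Lie algebras *)

Section PresentationTheory.
Variables (K : comNzRingType) (X : Type) (rel : lie_term K X -> lie_term K X -> Prop).
Local Notation G := (lie_pres rel).
Local Open Scope quotient_scope.

Lemma pi_lieD s t : \pi_G (LAdd s t) = \pi_G s + \pi_G t :> G.
Proof. by rewrite -lp_addE. Qed.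

Lemma pi_lieZ a s : \pi_G (LScale a s) = a *: \pi_G s :> G.
Proof. by rewrite -lp_scaleE. Qed.

Lemma pi_lieN s : \pi_G (LOpp s) = - \pi_G s :> G.
Proof. by rewrite -lp_oppE. Qed.

Lemma pi_lieB s t : \pi_G (LBr s t) = lie (\pi_G s : G) (\pi_G t : G) :> G.
Proof. by rewrite -lp_brE. Qed.

Lemma pi_rel s t : rel s t -> \pi_G s = \pi_G t :> G.
Proof. by move=> st; apply/lie_pi_eq; exact: LC_rel. Qed.

Lemma lie_pres_ind (Q : G -> Prop) :
    (forall x, Q (lie_gen rel x)) -> Q 0 ->
    (forall x y, Q x -> Q y -> Q (x + y)) ->
    (forall a x, Q x -> Q (a *: x)) ->
    (forall x y, Q x -> Q y -> Q (lie x y)) ->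
  forall x, Q x.
Proof.
move=> Qg Q0 QD QZ QB; elim/quotW; elim=> [x||s IHs|s IHs t IHt|a s IHs|s IHs t IHt].
- exact: Qg.
- exact: Q0.
- by rewrite pi_lieN -scaleN1r; exact: QZ.
- by rewrite pi_lieD; exact: QD.
- by rewrite pi_lieZ; exact: QZ.
- by rewrite pi_lieB; exact: QB.
Qed.

Section Lift.
Variables (L : lieAlgType K) (phi : X -> L).

Fixpoint lie_eval (s : lie_term K X) : L :=
  match s with
  | LGen x => phi x
  | LZero => 0
  | LOpp s => - lie_eval s
  | LAdd s t => lie_eval s + lie_eval t
  | LScale a s => a *: lie_eval s
  | LBr s t => lie (lie_eval s) (lie_eval t)
  end.

Hypothesis phi_rel : forall s t, rel s t -> lie_eval s = lie_eval t.

Lemma lie_eval_cong s t : lie_cong rel s t -> lie_eval s = lie_eval t.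
Proof.
elim=> //= {s t}.
- by move=> s t u _ -> _ ->.
- by move=> s s' _ ->.
- by move=> s s' t t' _ -> _ ->.
- by move=> a s s' _ ->.
- by move=> s s' t t' _ -> _ ->.
- by move=> s t u; rewrite addrA.
- by move=> s t; rewrite addrC.
- by move=> s; rewrite add0r.
- by move=> s; rewrite addNr.
- by move=> a b s; rewrite scalerA.
- by move=> s; rewrite scale1r.
- by move=> a s t; rewrite scalerDr.
- by move=> a b s; rewrite scalerDl.
- by move=> s t u; rewrite lieDl.
- by move=> s t u; rewrite lieDr.
- by move=> a s t; rewrite lieZl.
- by move=> a s t; rewrite lieZr.
- by move=> s; rewrite liexx.
- by move=> s t u; rewrite lie_jacobi.
Qed.

Definition lie_lift (x : G) : L := lie_eval (repr x).

Lemma lie_lift_pi s : lie_lift (\pi_G s) = lie_eval s.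
Proof. exact/lie_eval_cong/repr_lie_pi. Qed.

Lemma lie_lift_gen x : lie_lift (lie_gen rel x) = phi x.
Proof. exact: lie_lift_pi. Qed.

Lemma lie_lift0 : lie_lift 0 = 0.
Proof. exact: lie_lift_pi. Qed.

Lemma lie_liftD x y : lie_lift (x + y) = lie_lift x + lie_lift y.
Proof.
by elim/quotW: x => s; elim/quotW: y => t; rewrite -pi_lieD !lie_lift_pi.
Qed.

Lemma lie_liftZ a x : lie_lift (a *: x) = a *: lie_lift x.
Proof. by elim/quotW: x => s; rewrite -pi_lieZ !lie_lift_pi. Qed.

Lemma lie_lift_lie x y : lie_lift (lie x y) = lie (lie_lift x) (lie_lift y).
Proof.
by elim/quotW: x => s; elim/quotW: y => t; rewrite -pi_lieB !lie_lift_pi.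
Qed.

End Lift.
End PresentationTheory.

(** * Roots of the Kac-Moody algebra *)

Section LinearSpan.
Variables (K : nzRingType) (V : lmodType K).

(** Finite linear combinations, given inductively because the ambient module may be
    infinite-dimensional. *)
Inductive lspan (T : V -> Prop) : V -> Prop :=
  | lspan_nil : lspan T 0
  | lspan_cons a y x : T y -> lspan T x -> lspan T (a *: y + x).

Lemma lspanD T x y : lspan T x -> lspan T y -> lspan T (x + y).
Proof.
move=> Tx Ty; elim: Tx => [|a z {}x Tz _ IH]; first by rewrite add0r.
by rewrite -addrA; exact: lspan_cons.
Qed.

Lemma lspanZ T a x : lspan T x -> lspan T (a *: x).
Proof.
elim=> [|b z {}x Tz _ IH]; first by rewrite scaler0; exact: lspan_nil.
by rewrite scalerDr scalerA; exact: lspan_cons.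
Qed.

Lemma lspanN T x : lspan T x -> lspan T (- x).
Proof. by rewrite -scaleN1r; exact: lspanZ. Qed.

Lemma lspan_mem (T : V -> Prop) x : T x -> lspan T x.
Proof.
by move=> Tx; rewrite -[x]scale1r -[_ *: _]addr0; apply: lspan_cons (lspan_nil _).
Qed.

Lemma lspan_sub (T U : V -> Prop) x :
  (forall y, T y -> U y) -> lspan T x -> lspan U x.
Proof.
move=> TU; elim=> [|b z {}x Tz _ IH]; first exact: lspan_nil.
by apply: lspan_cons IH; exact: TU.
Qed.

Lemma lspan_sum T x : lspan T x -> exists2 s : seq V,
  forall y, y \in s -> exists a z, T z /\ y = a *: z & x = \sum_(y <- s) y.
Proof.
elim=> [|b z {}x Tz _ [s sT ->]]; first by exists [::]; rewrite ?big_nil.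
exists (b *: z :: s); last by rewrite big_cons.
by move=> y; rewrite inE => /orP[/eqP->|/sT//]; exists b, z.
Qed.

End LinearSpan.

Lemma lspan_lie (K : comNzRingType) (L : lieAlgType K) (T U : L -> Prop) x z :
  (forall y, T y -> lspan U (lie x y)) -> lspan T z -> lspan U (lie x z).
Proof.
move=> TU; elim=> [|b y {}z Ty _ IH]; first by rewrite lie0r; exact: lspan_nil.
by rewrite lieDr lieZr; apply: lspanD IH; apply/lspanZ/TU.
Qed.

Section KacMoodyRoots.
Variables (R : realType) (l : nat) (A : 'M[int]_l).
Variables (h : vectType R[i]) (alpha : 'I_l -> hdual R h) (alphav : 'I_l -> h).

Local Notation rel := (km_relation A alpha alphav).
Local Notation g := (kac_moody A alpha alphav).
Local Notation H t := (km_h A alpha alphav t).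
Local Notation e i := (lie_gen rel (KMe h i) : g).
Local Notation f i := (lie_gen rel (KMf h i) : g).
Local Notation wspace b x :=
  (km_root_space (A := A) (simple_root := alpha) (simple_coroot := alphav) b x).

Lemma pi_iter_br n (s t : lie_term R[i] (km_generator l h)) :
  \pi_(lie_pres rel)%qT (iter n (LBr s) t) =
  iter n (lie (\pi_(lie_pres rel)%qT s : g)) (\pi_(lie_pres rel)%qT t) :> g.
Proof. by elim: n => //= n IHn; rewrite pi_lieB IHn. Qed.

Lemma km_h_lin a x y : H (a *: x + y) = a *: H x + H y.
Proof. by rewrite -pi_lieZ -pi_lieD; apply: pi_rel; exact: KMR_lin. Qed.

Lemma km_h0 : H 0 = 0.
Proof.
have := km_h_lin 1 0 0; rewrite scaler0 addr0 scale1r => /eqP.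
by rewrite -subr_eq subrr eq_sym => /eqP.
Qed.

Lemma km_hN x : H (- x) = - H x.
Proof. by have := km_h_lin (-1) x 0; rewrite km_h0 !addr0 !scaleN1r. Qed.

Lemma lie_hh x y : lie (H x) (H y) = 0.
Proof. by rewrite -pi_lieB; apply: pi_rel; exact: KMR_hh. Qed.

Lemma lie_ef i : lie (e i) (f i) = H (alphav i).
Proof. by rewrite -pi_lieB; apply: pi_rel; exact: KMR_ef_eq. Qed.

Lemma lie_ef_neq i j : i != j -> lie (e i) (f j) = 0.
Proof. by move=> ij; rewrite -pi_lieB; apply: pi_rel; exact: KMR_ef_neq. Qed.

Lemma lie_he x i : lie (H x) (e i) = (alpha i x : R[i]) *: e i.
Proof. by rewrite -pi_lieB -pi_lieZ; apply: pi_rel; exact: KMR_he. Qed.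

Lemma lie_hf x i : lie (H x) (f i) = - (alpha i x : R[i]) *: f i.
Proof. by rewrite -pi_lieB -pi_lieZ; apply: pi_rel; exact: KMR_hf. Qed.

Lemma serre_e i j : i != j -> iter `|1 - A i j|%N (lie (e i)) (e j) = 0.
Proof. by move=> ij; rewrite -pi_iter_br; apply: pi_rel; exact: KMR_serre_e. Qed.

Lemma serre_f i j : i != j -> iter `|1 - A i j|%N (lie (f i)) (f j) = 0.
Proof. by move=> ij; rewrite -pi_iter_br; apply: pi_rel; exact: KMR_serre_f. Qed.

(** * The Chevalley involution and local nilpotency *)

Definition chevalley_gen (x : km_generator l h) : g :=
  match x with KMh t => H (- t) | KMe i => f i | KMf i => e i end.

(** The relations for [e] and [f] are exchanged. Swapping [e i] and [f i] without signs is
    consistent, since reversing their bracket negates the coroot, as the map does on [h]. *)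
Lemma chevalley_rel s t : rel s t ->
  lie_eval chevalley_gen s = lie_eval chevalley_gen t.
Proof.
have iterE n u v : lie_eval chevalley_gen (iter n (LBr u) v) =
    iter n (lie (lie_eval chevalley_gen u)) (lie_eval chevalley_gen v).
  by elim: n => //= n ->.
case=> /= {s t}.
- by move=> a x y; rewrite opprD -scalerN km_h_lin.
- by move=> x y; rewrite lie_hh.
- by move=> i; rewrite lieC lie_ef km_hN.
- by move=> i j ij; rewrite lieC lie_ef_neq 1?eq_sym // oppr0.
- by move=> x i; rewrite km_hN lieNl lie_hf scaleNr opprK.
- by move=> x i; rewrite km_hN lieNl lie_he scaleNr.
- by move=> i j ij; rewrite iterE /= serre_f.
- by move=> i j ij; rewrite iterE /= serre_e.
Qed.

Definition chevalley : g -> g := lie_lift chevalley_gen.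

Lemma chevalley_h t : chevalley (H t) = - H t.
Proof. by rewrite [LHS]lie_lift_gen //; [exact: km_hN|exact: chevalley_rel]. Qed.

Lemma chevalley_e i : chevalley (e i) = f i.
Proof. by rewrite [LHS]lie_lift_gen //; exact: chevalley_rel. Qed.

Lemma chevalley_f i : chevalley (f i) = e i.
Proof. by rewrite [LHS]lie_lift_gen //; exact: chevalley_rel. Qed.

Lemma chevalley0 : chevalley 0 = 0.
Proof. by apply: lie_lift0; exact: chevalley_rel. Qed.

Lemma chevalleyD x y : chevalley (x + y) = chevalley x + chevalley y.
Proof. by apply: lie_liftD; exact: chevalley_rel. Qed.

Lemma chevalleyZ a x : chevalley (a *: x) = a *: chevalley x.
Proof. by apply: lie_liftZ; exact: chevalley_rel. Qed.

Lemma chevalley_lie x y : chevalley (lie x y) = lie (chevalley x) (chevalley y).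
Proof. by apply: lie_lift_lie; exact: chevalley_rel. Qed.

Lemma chevalleyK : involutive chevalley.
Proof.
apply: lie_pres_ind => [[t|i|i]||x y xK yK|a x xK|x y xK yK].
- by rewrite chevalley_h -scaleN1r chevalleyZ chevalley_h scaleN1r opprK.
- by rewrite chevalley_e chevalley_f.
- by rewrite chevalley_f chevalley_e.
- by rewrite !chevalley0.
- by rewrite !chevalleyD xK yK.
- by rewrite !chevalleyZ xK.
- by rewrite !chevalley_lie xK yK.
Qed.

Lemma iter_chevalley n x y :
  chevalley (iter n (lie x) y) = iter n (lie (chevalley x)) (chevalley y).
Proof. by elim: n => //= n <-; exact: chevalley_lie. Qed.

Lemma chevalley_wspace (b : hdual R h) x : wspace b x -> wspace (- b) (chevalley x).
Proof.
move=> bx t; rewrite -[H t]chevalleyK -chevalley_lie chevalley_h lieNl bx.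
by rewrite -scaleNr chevalleyZ opp_lfunE.
Qed.

(** By the Leibniz rule it is enough to treat generators: the Serre relation handles [e j], while
    [f i] reaches a multiple of [e i] through the coroot. *)
Lemma ad_nil_e i x : ad_nil (e i) x.
Proof.
have ad0 (u v : g) : lie u v = 0 -> ad_nil u v by exists 1%N.
have adS (u v : g) : ad_nil u (lie u v) -> ad_nil u v.
  by move=> [n vn]; exists n.+1; rewrite iterSr.
have ad_h t : ad_nil (e i) (H t).
  by apply/adS/ad0; rewrite (lieC _ (H t)) lie_he lieNr lieZr liexx scaler0 oppr0.
elim/lie_pres_ind: x => [[t|j|j]||x y|a x|x y].
- exact: ad_h.
- have [->|ij] := eqVneq i j; first by apply/ad0/liexx.
  by eexists; exact: serre_e.
- have [<-|ij] := eqVneq i j; last by apply/ad0/lie_ef_neq.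
  by apply: adS; rewrite lie_ef; exact: ad_h.
- exact/ad0/lie0r.
- exact: ad_nilD.
- exact: ad_nilZ.
- exact: ad_nil_lie.
Qed.

Lemma ad_nil_f i x : ad_nil (f i) x.
Proof.
have [n nx] := ad_nil_e i (chevalley x).
by exists n; rewrite -[LHS]chevalleyK iter_chevalley chevalley_f nx chevalley0.
Qed.

(** * Bracket monomials and weights *)

Definition emono i (s : seq 'I_l) : g := foldr (fun j x => lie (e j) x) (e i) s.

Definition wt (v : 'rV[int]_l) : hdual R h :=
  \sum_j (v 0 j)%:~R *: alpha j.

Lemma wtD u v : wt (u + v) = wt u + wt v.
Proof.
by rewrite -big_split; apply: eq_bigr => j _; rewrite mxE rmorphD scalerDl.
Qed.

Lemma wtN v : wt (- v) = - wt v.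
Proof.
by rewrite -sumrN; apply: eq_bigr => j _; rewrite mxE rmorphN scaleNr.
Qed.

Lemma wt0 : wt 0 = 0.
Proof. by rewrite /wt big1 // => j _; rewrite mxE scale0r. Qed.

Lemma wt_sr i : wt (delta_mx 0 i) = alpha i.
Proof.
rewrite /wt (bigD1 i) //= big1 => [|j ji]; first by rewrite mxE !eqxx scale1r addr0.
by rewrite mxE (negPf ji) andbF scale0r.
Qed.

Definition content (s : seq 'I_l) : 'rV[int]_l := \sum_(k <- s) delta_mx 0 k.

Lemma content_cons k s : content (k :: s) = delta_mx 0 k + content s.
Proof. exact: big_cons. Qed.

Lemma contentE s k : content s 0 k = (count_mem k s)%:Z.
Proof.
elim: s => [|j s IHs]; first by rewrite /content big_nil mxE.
by rewrite content_cons mxE IHs mxE eqxx /= eq_sym; case: eqP.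
Qed.

Lemma wspaceD (b c : hdual R h) x y :
  wspace b x -> wspace c y -> wspace (b + c) (lie x y).
Proof.
by move=> bx cy t; rewrite lie_leibniz bx cy lieZl lieZr -scalerDl add_lfunE.
Qed.

Lemma wspace_e i : wspace (alpha i) (e i).
Proof. by move=> t; rewrite lie_he. Qed.

Lemma wspace_f i : wspace (- alpha i) (f i).
Proof. by move=> t; rewrite lie_hf opp_lfunE. Qed.

Lemma wspace_emono i s : wspace (wt (content (i :: s))) (emono i s).
Proof.
elim: s => [|j s IHs].
  by rewrite /content big_seq1 wt_sr; exact: wspace_e.
rewrite !content_cons addrCA -content_cons wtD wt_sr.
by apply: wspaceD IHs; exact: wspace_e.
Qed.

Lemma wspace_inj (b c : hdual R h) x : x <> 0 -> wspace b x -> wspace c x -> b = c.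
Proof.
move=> /eqP x0 bx cx; apply/lfunP => t.
have /eqP := bx t; rewrite cx -subr_eq0 -scalerBl scaler_eq0 (negPf x0) orbF.
by rewrite subr_eq0 => /eqP.
Qed.

(* Applying [lie (H t) - c t] for a weight [c != b] with [c t != b t] kills a
   summand and rescales the others. *)
Lemma weight_component (b : hdual R h) x (s : seq g) :
    wspace b x -> x <> 0 -> (forall y, y \in s -> exists c, wspace c y) ->
    x = \sum_(y <- s) y ->
  exists y, [/\ y \in s, y <> 0 & wspace b y].
Proof.
have [n] := ubnP (size s); elim: n s x => // n IHn [|y s] x les bx x0 ws.
  by rewrite big_nil => /x0.
have [c cy] : exists c, wspace c y by apply: ws; rewrite inE eqxx.
have {}ws z : z \in s -> exists c, wspace c z.
  by move=> zs; apply: ws; rewrite inE zs orbT.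
rewrite big_cons => xE.
have [cb|cb] := pselect (c = b).
  have [y0|y0] := pselect (y = 0); last first.
    by exists y; split=> //; [rewrite inE eqxx|rewrite -cb].
  have [||z [zs z0 bz]] := IHn s x _ bx x0 ws; first exact: les.
    by rewrite xE y0 add0r.
  by exists z; split=> //; rewrite inE zs orbT.
have [t tbc] : exists t, c t != b t.
  apply: contrapT => nt; apply: cb; apply/lfunP => t.
  by apply/eqP/negPn/negP => ?; apply: nt; exists t.
pose D (z : g) := lie (H t) z - (c t : R[i]) *: z.
have DE (a : hdual R h) z : wspace a z -> D z = ((a t : R[i]) - c t) *: z.
  by move=> az; rewrite /D az scalerBl.
have Dw (a : hdual R h) z : wspace a z -> wspace a (D z).
  by move=> az r; rewrite (DE _ _ az) lieZr az !scalerA mulrC.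
have [|||||z' [/mapP[z zs ->] Dz0 bDz]] := IHn (map D s) (D x).
- by rewrite size_map.
- exact: Dw.
- rewrite (DE _ _ bx) => /eqP; rewrite scaler_eq0 subr_eq0 eq_sym (negPf tbc) /=.
  by move/eqP.
- by move=> _ /mapP[z /ws[a az] ->]; exists a; exact: Dw.
- rewrite big_map {1}/D xE lieDr scalerDr opprD addrACA.
  rewrite -[lie _ y - _]/(D y) (DE _ _ cy) subrr scale0r add0r.
  by rewrite lie_sumr scaler_sumr -sumrB.
exists z; have [a az] := ws z zs.
have z0 : z <> 0 by move=> z0; apply: Dz0; rewrite z0 /D lie0r scaler0 subr0.
split=> //; first by rewrite inE zs orbT.
by rewrite -(wspace_inj Dz0 (Dw _ _ az) bDz).
Qed.

(** * Triangular decomposition *)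

Inductive upper : g -> Prop :=
  | upper_h t : upper (H t)
  | upper_e i s : upper (emono i s).

(** The negative half is the Chevalley image of the positive one, so monomials in [f] never appear
    explicitly. *)
Definition triangular (x : g) : Prop := upper x \/ upper (chevalley x).

Lemma lspan_chevalley T U x : (forall y, T y -> lspan U (chevalley y)) ->
  lspan T x -> lspan U (chevalley x).
Proof.
move=> TU; elim=> [|a y {}x Ty _ IH]; first by rewrite chevalley0; exact: lspan_nil.
by rewrite chevalleyD chevalleyZ; apply: lspanD IH; apply/lspanZ/TU.
Qed.

Lemma triangular_chevalley x : lspan triangular x -> lspan triangular (chevalley x).
Proof.
apply: lspan_chevalley => y [uy|uy]; apply: lspan_mem; last by left.
by right; rewrite chevalleyK.
Qed.

Lemma lie_e_upper i x : lspan upper x -> lspan upper (lie (e i) x).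
Proof.
apply: lspan_lie => _ [t|j s].
  rewrite lieC lie_he -scaleNr; apply/lspanZ/lspan_mem.
  exact: (upper_e i [::]).
by apply: lspan_mem; exact: (upper_e j (i :: s)).
Qed.

(** [lie (f i)] acts as a derivation, turning a letter [e i] into a coroot; the coroot acts on the
    rest of the monomial by a scalar. *)
Lemma lie_f_emono i j s : lspan upper (lie (f i) (emono j s)).
Proof.
have fe k : lie (f i) (e k) = if k == i then - H (alphav i) else 0.
  rewrite lieC; case: eqP => [->|/eqP ki]; first by rewrite lie_ef.
  by rewrite lie_ef_neq // oppr0.
elim: s => /= [|k s IHs].
  rewrite fe; case: ifP => _; last exact: lspan_nil.
  by apply/lspanN/lspan_mem/upper_h.
rewrite lie_leibniz; apply: lspanD; last exact: lie_e_upper.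
rewrite fe; case: ifP => _; last by rewrite lie0l; exact: lspan_nil.
rewrite lieNl wspace_emono; apply/lspanN/lspanZ/lspan_mem; exact: upper_e.
Qed.

Lemma lie_e_triangular i x : lspan triangular x -> lspan triangular (lie (e i) x).
Proof.
apply: lspan_lie => y [/lspan_mem/(lie_e_upper i)|].
  by apply: lspan_sub; left.
move yE: (chevalley y) => z uz; case: uz yE => [t|j s] yE.
  rewrite -[y]chevalleyK yE chevalley_h lieNr -lieC lie_he.
  by apply/lspanZ/lspan_mem; left; exact: (upper_e i [::]).
rewrite -chevalley_f -[y]chevalleyK -chevalley_lie yE.
by apply: triangular_chevalley; apply: lspan_sub (lie_f_emono i j s); left.
Qed.

Lemma lie_f_triangular i x : lspan triangular x -> lspan triangular (lie (f i) x).
Proof.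
move=> Tx; rewrite -chevalley_e -[x]chevalleyK -chevalley_lie.
exact/triangular_chevalley/lie_e_triangular/triangular_chevalley.
Qed.

Lemma lie_h_triangular t x : lspan triangular x -> lspan triangular (lie (H t) x).
Proof.
have upr y : upper y -> exists a, lie (H t) y = a *: y.
  case=> [r|i s]; first by exists 0; rewrite lie_hh scale0r.
  by eexists; exact: wspace_emono.
apply: lspan_lie => y [uy|uy].
  by have [a ->] := upr _ uy; apply/lspanZ/lspan_mem; left.
have [a E] := upr _ uy.
rewrite -[lie _ _]chevalleyK chevalley_lie chevalley_h lieNl E -scaleNr.
by rewrite chevalleyZ chevalleyK; apply/lspanZ/lspan_mem; right.
Qed.

(** Only spanning is asserted. The induction also carries stability of the span under [lie x], which
    settles brackets through the Jacobi identity. *)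
Lemma triangular_decomposition x : lspan triangular x.
Proof.
suff [] : lspan triangular x /\
  forall z, lspan triangular z -> lspan triangular (lie x z) by [].
elim/lie_pres_ind: x => [[t|i|i]||x y [Tx Lx] [Ty Ly]|a x [Tx Lx]|x y [Tx Lx] [Ty Ly]].
- split; last exact: lie_h_triangular.
  by apply: lspan_mem; left; exact: upper_h.
- split; last exact: lie_e_triangular.
  by apply: lspan_mem; left; exact: (upper_e i [::]).
- split; last exact: lie_f_triangular.
  by apply: lspan_mem; right; rewrite chevalley_f; exact: (upper_e i [::]).
- split; first exact: lspan_nil.
  by move=> z _; rewrite lie0l; exact: lspan_nil.
- split; first exact: lspanD.
  by move=> z Tz; rewrite lieDl; apply: lspanD; [exact: Lx|exact: Ly].
- split; first exact: lspanZ.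
  by move=> z Tz; rewrite lieZl; apply/lspanZ/Lx.
- split; first exact: Lx.
  move=> z Tz; rewrite -[lie (lie x y) z](addrK (lie y (lie x z))) -lie_leibniz.
  by apply: lspanD; [exact/Lx/Ly|exact/lspanN/Ly/Lx].
Qed.

(** A root vector is a sum of triangular weight vectors, one of which is nonzero of the same weight.
    The nonvanishing monomial is recorded because multiples and supports of roots are read off from
    it. *)
Lemma root_content (b : hdual R h) : km_roots A alpha alphav b ->
  exists i s, emono i s <> 0 /\
    (b = wt (content (i :: s)) \/ b = - wt (content (i :: s))).
Proof.
move=> [b0 [x bx x0]].
have [s sT xE] := lspan_sum (triangular_decomposition x).
have upw y : upper y -> exists2 c, wspace c y &
    (c = 0 \/ exists i s, y = emono i s /\ c = wt (content (i :: s))).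
  case=> [t|i u]; last first.
    by exists (wt (content (i :: u))); [exact: wspace_emono|right; exists i, u].
  by exists 0; [move=> r; rewrite lie_hh lfunE scale0r|left].
have wspaceZ c a y : wspace c y -> wspace c (a *: y).
  by move=> cy t; rewrite lieZr cy !scalerA mulrC.
have triw y : triangular y -> exists2 c, wspace c y &
    c = 0 \/ exists i s, [/\ y <> 0 -> emono i s <> 0 &
       c = wt (content (i :: s)) \/ c = - wt (content (i :: s))].
  case=> /upw[c cy cE].
    exists c => //; case: cE => [|[i [u [-> ->]]]]; first by left.
    by right; exists i, u; split=> //; left.
  exists (- c); first by rewrite -[y]chevalleyK; exact: chevalley_wspace.
  case: cE => [->|[i [u [yE ->]]]]; first by left; rewrite oppr0.
  right; exists i, u; split; last by right.
  by move=> y0 E; apply: y0; rewrite -[y]chevalleyK yE E chevalley0.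
have [|y [/sT[a [z [/triw[c cz cE] yE]]] y0 by_]] := weight_component bx x0 _ xE.
  by move=> y /sT[a [z [/triw[c cz _] ->]]]; exists c; exact: wspaceZ.
have bc : b = c by apply: wspace_inj y0 by_ _; rewrite yE; exact: wspaceZ.
case: cE => [c0|[i [u [nz cE]]]]; first by case: b0; rewrite bc.
exists i, u; rewrite bc; split=> //; apply: nz => z0.
by apply: y0; rewrite yE z0 scaler0.
Qed.

(** * The roots as an abstract root set in the lattice *)

Hypothesis realA : realization A alpha alphav.
Hypothesis diagA : forall i, A i i = 2.

Lemma wt_eq0 v : wt v = 0 -> v = 0.
Proof.
move=> v0; apply/rowP => j; rewrite mxE.
have /freeP fr : free [tuple alpha i | i < l].
  by have := realization_root_free realA; rewrite -val_ord_tuple.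
have := fr (fun i => (v 0 i)%:~R) _ j => /(_ _)/eqP.
rewrite intr_eq0 => E; apply/eqP/E; rewrite -[RHS]v0.
by apply: eq_bigr => i _; rewrite -tnth_nth tnth_mktuple.
Qed.

Lemma wt_inj : injective wt.
Proof.
move=> u v uv; apply/eqP; rewrite -subr_eq0; apply/eqP/wt_eq0.
by rewrite wtD wtN uv subrr.
Qed.

Lemma wt_coroot v i : wt v (alphav i) = (cpair A v i)%:~R.
Proof.
rewrite sum_lfunE rmorph_sum; apply: eq_bigr => j _.
by rewrite scale_lfunE (realization_pairing realA) rmorphM /= mulrC.
Qed.

Definition lattice_root (v : 'rV[int]_l) : Prop := km_roots A alpha alphav (wt v).

Lemma lattice_root_content v : lattice_root v ->
  exists i s, emono i s <> 0 /\ (v = content (i :: s) \/ v = - content (i :: s)).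
Proof.
move=> /root_content[i [s [nz vE]]]; exists i, s; split=> //.
by case: vE => [|]; rewrite -?wtN => /wt_inj; [left|right].
Qed.

Lemma lattice_root0 : ~ lattice_root 0.
Proof. by case=> /(_ wt0). Qed.

Lemma lattice_root_sign v : lattice_root v -> nonneg v \/ nonneg (- v).
Proof.
have pos s : nonneg (content s) by move=> j; rewrite contentE.
by move=> /lattice_root_content[i [s [_ [->|->]]]]; [left|right; rewrite opprK].
Qed.

Lemma lattice_rootN v : lattice_root v -> lattice_root (- v).
Proof.
rewrite /lattice_root wtN => -[v0 [x vx x0]]; split.
  by move=> /eqP; rewrite oppr_eq0 => /eqP.
exists (chevalley x); first exact: chevalley_wspace.
by move=> E; apply: x0; rewrite -[x]chevalleyK E chevalley0.
Qed.

Lemma lie_coroot_e i : lie (H (alphav i)) (e i) = 2 *: e i.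
Proof. by rewrite lie_he (realization_pairing realA) diagA. Qed.

Lemma lie_coroot_f i : lie (H (alphav i)) (f i) = - 2 *: f i.
Proof. by rewrite lie_hf (realization_pairing realA) diagA. Qed.

(** If [e i] killed the root vector, it would be a highest weight vector of negative weight for a
    locally nilpotent [f i], hence zero. *)
Lemma lattice_root_string v i : lattice_root v -> cpair A v i < 0 ->
  v + delta_mx 0 i = 0 \/ lattice_root (v + delta_mx 0 i).
Proof.
move=> [v0 [x vx x0]] vi.
have [->|vin0] := eqVneq (v + delta_mx 0 i) 0; first by left.
right; split; first by move=> /wt_eq0/eqP; rewrite (negPf vin0).
exists (lie (e i) x).
  by rewrite wtD wt_sr addrC; apply: wspaceD vx; exact: wspace_e.
move=> ex; apply: x0.
apply: (sl2_highest_lt0 (lie_ef i) (lie_coroot_f i) _ _ ex (ad_nil_f i x)).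
  exact: vx.
by rewrite wt_coroot ltrz0.
Qed.

(** For pairing [m >= 0] the [m]-th power of [lie (f i)] moves a root vector to the reflected
    weight, injectively by [sl2_string]. Negative pairings follow by passing to [- v]. *)
Lemma lattice_root_refl v i : lattice_root v -> lattice_root (refl A i v).
Proof.
suff pos (m : nat) u : lattice_root u -> cpair A u i = m -> lattice_root (refl A i u).
  move=> Pv; case E : (cpair A v i) => [m|m]; first exact: pos E.
  rewrite -[v]opprK reflN; apply: lattice_rootN; apply: (pos m.+1).
    exact: lattice_rootN.
  by rewrite cpairN E NegzE opprK.
move=> [u0 [x ux x0]] um; split.
  move=> /wt_eq0 E; apply: u0; rewrite -[u](reflK diagA i) E.
  by rewrite -(scale0r (0 : 'rV[int]_l)) reflZ !scale0r wt0.
exists (iter m (lie (f i)) x).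
  rewrite /refl um; elim: (m) => [|k IHk]; first by rewrite scale0r subr0.
  have -> : u - k.+1%:Z *: delta_mx 0 i = - delta_mx 0 i + (u - k%:Z *: delta_mx 0 i).
    by apply/rowP => j; rewrite !mxE; lia.
  by rewrite wtD wtN wt_sr; apply: wspaceD IHk; exact: wspace_f.
move=> fx; apply: x0.
apply: (sl2_string (lie_ef i) (lie_coroot_e i) (lie_coroot_f i) _ (ad_nil_e i x) fx).
by rewrite ux wt_coroot um.
Qed.

(** The content forces every letter of the monomial to be [i], and such a monomial with more than
    one letter contains [lie (e i) (e i)], which is zero. *)
Lemma lattice_root_multiple a i :
  lattice_root (a *: delta_mx 0 i) -> a = 1 \/ a = -1.
Proof.
move=> /lattice_root_content[j [s [nz aE]]].
have all_i k : k \in j :: s -> k = i.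
  move=> ks; apply: contrapT => /eqP ki.
  have : content (j :: s) 0 k = 0.
    case: aE => /rowP/(_ k); rewrite !mxE (negPf ki) andbF mulr0 => /esym // /eqP.
    by rewrite oppr_eq0 => /eqP.
  have : (0 < count_mem k (j :: s))%N by rewrite -has_count has_pred1.
  by rewrite contentE; case: (count_mem _ _).
have ji : j = i by apply: all_i; rewrite inE eqxx.
have s0 : s = [::].
  have sE : emono j s = iter (size s) (lie (e i)) (e i).
    rewrite ji; elim: s {nz aE} all_i => //= k s IHs all_i.
    rewrite IHs => [|k' ks']; last first.
      by apply: all_i; move: ks'; rewrite !inE => /orP[->|->]; rewrite ?orbT.
    by rewrite (all_i k) // !inE eqxx orbT.
  case: s sE nz {aE all_i} => // k s -> [].
  by rewrite iterSr liexx iter_lie0.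
move: aE; rewrite s0 ji /content big_seq1.
by case=> /rowP/(_ i); rewrite !mxE !eqxx mulr1; [left|right].
Qed.

(** The letter [j] occurs in a nonzero monomial of content [v] or [- v], so [e j] cannot be zero. *)
Lemma lattice_root_support v j :
  lattice_root v -> v 0 j != 0 -> lattice_root (delta_mx 0 j).
Proof.
move=> /lattice_root_content[i [s [nz vE]]] vj.
have js : j \in i :: s.
  rewrite -has_pred1 has_count lt0n; apply: contraNneq vj => c0.
  by case: vE => ->; rewrite ?mxE contentE c0.
split.
  by move/wt_eq0/rowP/(_ j); rewrite !mxE !eqxx.
exists (e j); first by rewrite wt_sr; exact: wspace_e.
move=> ej0; apply: nz.
elim: s js {vE} => [|k s IHs]; rewrite !inE; first by move/eqP<-.
case/or3P=> [ji|/eqP<-|js] /=.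
- by rewrite IHs ?lie0r // inE ji.
- by rewrite ej0 lie0l.
- by rewrite IHs ?lie0r // inE js orbT.
Qed.

End KacMoodyRoots.

Local Open Scope classical_set_scope.

Theorem proposition3p4 (R : realType) (l : nat) (A : 'M[int]_l)
    (h : vectType R[i])
    (alpha : 'I_l -> hdual R h) (alphav : 'I_l -> h)
    (affine_A : affine_Cartan R A)
    (realization_h : realization A alpha alphav)
    (S : set (hdual R h))
    (S_sub : S `<=` km_roots A alpha alphav)
    (S_closed : km_closed A alpha alphav S)
    (n : nat) (beta : 'I_n -> hdual R h)
    (beta_in_S : forall i, S (beta i))
    (sum_root : km_roots A alpha alphav (\sum_(i < n) beta i)) :
  S (\sum_(i < n) beta i).
Proof.
have [gcmA _ [d [d_gt0 psdA rankA]]] := affine_A.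
have diagA := gcm_diag gcmA.
(* Every root is an integral combination of simple roots, so the question can be pulled back along
   [wt] to the lattice. *)
have /choice[b betaE] : forall i, exists v, beta i = wt alpha v.
  move=> i; have [j [s [_ [->|->]]]] := root_content (S_sub _ (beta_in_S i)).
    by eexists.
  by rewrite -wtN; eexists.
have sumE : \sum_(i < n) beta i = wt alpha (\sum_(v <- map b (enum 'I_n)) v).
  rewrite (big_morph (wt alpha) (wtD alpha) (wt0 alpha)) big_map big_enum.
  by apply: eq_bigr => i _; rewrite betaE.
move: sum_root; rewrite sumE.
have main := closed_sum d_gt0 psdA rankA diagA (P := lattice_root A alpha alphav).
apply: (main _ _ _ _ _ _ _ (fun v => S (wt alpha v))).
- exact: lattice_root0.
- exact: lattice_root_sign.
- exact: lattice_rootN.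
- by move=> v i; exact: lattice_root_string.
- by move=> v i; exact: lattice_root_refl.
- by move=> a i; exact: lattice_root_multiple.
- by move=> v j; exact: lattice_root_support.
- by move=> v; exact: S_sub.
- by move=> u v Su Sv; rewrite /lattice_root wtD; exact: S_closed.
- by move=> _ /mapP[i _ ->]; rewrite -betaE.
Qed.
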